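(* Let $(\mathcal{M},\upsilon,M,\mathfrak{a},[\bullet,\bullet,\bullet]_{\mathcal{M}})$ be a $3$-Lie algebroid over a manifold $M$, and assume that $\mathcal{M}\cong\mathcal{A}\times\mathcal{B}$ as vector bundles for two complementary $3$-anchored bundles $(\mathcal{A},\tau=\upsilon|_{\mathcal{A}},M)$ and $(\mathcal{B},\kappa=\upsilon|_{\mathcal{B}},M)$, whose $3$-anchors $\mathfrak{a}_{\mathcal{A}},\mathfrak{a}_{\mathcal{B}}$ are the restrictions of $\mathfrak{a}$ to $\Gamma(\mathcal{A})\wedge\Gamma(\mathcal{A})$ and $\Gamma(\mathcal{B})\wedge\Gamma(\mathcal{B})$. Assume further that $$[\eta_1,\eta_2,X]_{\mathcal{M}}\in\Gamma(\mathcal{A}),\qquad [\eta,X_1,X_2]_{\mathcal{M}}\in\Gamma(\mathcal{B})$$ for all $X,X_1,X_2\in\Gamma(\mathcal{A})$ and $\eta,\eta_1,\eta_2\in\Gamma(\mathcal{B})$. Define the maps $\phi:\wedge^3\Gamma(\mathcal{A})\to\Gamma(\mathcal{A})$, $\zeta:\wedge^3\Gamma(\mathcal{A})\to\Gamma(\mathcal{B})$, $\psi:\wedge^3\Gamma(\mathcal{B})\to\Gamma(\mathcal{A})$, $\theta:\wedge^3\Gamma(\mathcal{B})\to\Gamma(\mathcal{B})$, $\rho:\Gamma(\mathcal{B})\wedge\Gamma(\mathcal{B})\otimes\Gamma(\mathcal{A})\to\Gamma(\mathcal{A})$ and $\sigma:\Gamma(\mathcal{B})\otimes\Gamma(\mathcal{A})\wedge\Gamma(\mathcal{A})\to\Gamma(\mathcal{B})$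 by the decomposition \begin{align*} [X_1,X_2,X_3]_{\mathcal{M}}&=\phi(X_1,X_2,X_3)+\zeta(X_1,X_2,X_3),\\ [\eta_1,\eta_2,\eta_3]_{\mathcal{M}}&=\psi(\eta_1,\eta_2,\eta_3)+\theta(\eta_1,\eta_2,\eta_3),\\ [\eta_1,\eta_2,X]_{\mathcal{M}}&=\rho(\eta_1,\eta_2,X),\\ [\eta,X_1,X_2]_{\mathcal{M}}&=\sigma(\eta,X_1,X_2). \end{align*} Then, under the identification $\mathcal{M}\cong\mathcal{A}\times\mathcal{B}$, the $3$-Lie algebroid $\mathcal{M}$ is the bicocycle double cross product ${\mathcal{A}}_{\zeta}\bowtie_{\psi}\mathcal{B}$ of $\mathcal{A}$ and $\mathcal{B}$ associated with the data $(\phi,\zeta,\psi,\theta,\rho,\sigma)$.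
   Context: $M$ is a smooth manifold; $\Gamma(E)$ denotes the smooth sections of a vector bundle $E\to M$. Sections $X\in\Gamma(\mathcal{A})$ and $\eta\in\Gamma(\mathcal{B})$ are identified with the sections $(X,0)$ and $(0,\eta)$ of the Whitney sum (fiberwise direct product) $\mathcal{A}\times\mathcal{B}$, whose general section is written $(X,\eta)$. A $3$-anchored bundle $(\mathcal{A},\tau,M,\mathfrak{a}_{\mathcal{A}})$ is a vector bundle $\tau:\mathcal{A}\to M$ with an $\mathbb{R}$-bilinear skew-symmetric map $\mathfrak{a}_{\mathcal{A}}:\Gamma(\mathcal{A})\wedge\Gamma(\mathcal{A})\to\Gamma(TM)$. A $3$-Lie algebroid is a $3$-anchored bundle with an $\mathbb{R}$-trilinear skew-symmetric bracket $[\bullet,\bullet,\bullet]$ on $\Gamma(\mathcal{A})$ such that, for all sections and all $f\in C^\infty(M)$: (1) $\mathfrak{a}_{\mathcal{A}}([X_1,X_2,Y_1]\wedge Y_2)+\mathfrak{a}_{\mathcal{A}}(Y_1\wedge[X_1,X_2,Y_2])=[\mathfrak{a}_{\mathcal{A}}(X_1\wedge X_2),\mathfrak{a}_{\mathcal{A}}(Y_1\wedge Y_2)]$ (Lie bracket of vector fields on the right); (2) $[X_1,X_2,[Y_1,Y_2,Y_3]]=[[X_1,X_2,Y_1],Y_2,Y_3]+[Y_1,[X_1,X_2,Y_2],Y_3]+[Y_1,Y_2,[X_1,X_2,Y_3]]$; (3) $[X_1,X_2,fY]=f[X_1,X_2,Y]+\mathfrak{a}_{\mathcal{A}}(X_1\wedge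 X_2)(f)Y$. Given $3$-anchored bundles $\mathcal{A},\mathcal{B}$ over $M$ and $\mathbb{R}$-trilinear maps $\phi,\zeta,\psi,\theta,\rho,\sigma$ with the domains and codomains listed in the claim ($\phi,\zeta,\psi,\theta$ skew-symmetric, $\rho$ skew in its two $\mathcal{B}$-arguments, $\sigma$ skew in its two $\mathcal{A}$-arguments), the bicocycle double cross product $3$-Lie algebroid ${\mathcal{A}}_{\zeta}\bowtie_{\psi}\mathcal{B}$ is the Whitney sum $\mathcal{A}\times\mathcal{B}$ with anchor $$\mathfrak{a}_{\mathcal{A}\times\mathcal{B}}\big((X_1,\eta_1)\wedge(X_2,\eta_2)\big)=\mathfrak{a}_{\mathcal{A}}(X_1\wedge X_2)+\mathfrak{a}_{\mathcal{B}}(\eta_1\wedge\eta_2)$$ and bracket $[(X_1,\eta_1),(X_2,\eta_2),(X_3,\eta_3)]_{{}_{\zeta}\bowtie_{\psi}}=(\widetilde X,\widetilde\eta)$, where $$\widetilde X=\phi(X_1,X_2,X_3)+\psi(\eta_1,\eta_2,\eta_3)+\rho(\eta_2,\eta_3,X_1)-\rho(\eta_1,\eta_3,X_2)+\rho(\eta_1,\eta_2,X_3),$$ $$\widetilde\eta=\theta(\eta_1,\eta_2,\eta_3)+\zeta(X_1,X_2,X_3)+\sigma(\eta_3,X_1,X_2)-\sigma(\eta_2,X_1,X_3)+\sigma(\eta_1,X_2,X_3),$$ whenever these define a $3$-Lie algebroid. *)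

(* Defs.v *)
From HB Require Import structures.
From mathcomp Require Import all_boot all_order all_algebra.
From mathcomp Require Import all_classical all_reals all_analysis.
From mathcomp Require Import ring.

Set Implicit Arguments.
Unset Strict Implicit.
Unset Printing Implicit Defensive.

Import Order.TTheory GRing.Theory Num.Theory.
Import numFieldNormedType.Exports.

Local Open Scope classical_set_scope.
Local Open Scope ring_scope.

Section SmoothEuclidean.
Variables (R : realType) (n : nat).
Implicit Types (U : set 'rV[R]_n) (f g : 'rV[R]_n -> R).

(* f is C^k on the open set U: all iterated partial derivatives of order at
   most k exist and are continuous at every point of U. *)
Fixpoint Ck (k : nat) U f : Prop :=
  (forall x, U x -> {for x, continuous f}) /\
  if k is k'.+1 then
    forall i : 'I_n, (forall x, U x -> derivable f x (delta_mx 0 i)) /\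
                     Ck k' U ('D_(delta_mx 0 i) f)
  else True.

Definition smooth_on U f := forall k, Ck k U f.

Lemma Ck_cont k U f : Ck k U f -> forall x, U x -> {for x, continuous f}.
Proof. by case: k => [|k] []. Qed.

Lemma CkS k U f : Ck k.+1 U f -> Ck k U f.
Proof.
elim: k f => [|k IH] f [cf df]; first by split.
by split=> // i; have [dfi /IH] := df i.
Qed.

Lemma Ck_sub k U V f : V `<=` U -> Ck k U f -> Ck k V f.
Proof.
move=> VU; elim: k f => [|k IH] f [cf df]; split=> //.
- by move=> x /VU /cf.
- by move=> x /VU /cf.
- by move=> i; have [dfi /IH cDf] := df i; split=> // x /VU /dfi.
Qed.

Lemma Ck_bigcup k (I : Type) (P : set I) (U : I -> set 'rV[R]_n) f :
  (forall i, P i -> Ck k (U i) f) -> Ck k (\bigcup_(i in P) U i) f.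
Proof.
elim: k f => [|k IH] f cf; split=> //.
- by move=> x [i Pi Uix]; exact: Ck_cont (cf i Pi) x Uix.
- by move=> x [i Pi Uix]; exact: Ck_cont (cf i Pi) x Uix.
- move=> j; split; first by move=> x [i Pi]; exact: ((cf i Pi).2 j).1.
  by apply: IH => i Pi; exact: ((cf i Pi).2 j).2.
Qed.

Lemma Ck_ext k U f g : open U -> (forall x, U x -> f x = g x) ->
  Ck k U f -> Ck k U g.
Proof.
move=> oU.
have nb (h h' : 'rV[R]_n -> R) x : (forall x, U x -> h x = h' x) -> U x -> {near x, h =1 h'}.
  by move=> hh' Ux; apply: filterS (open_nbhs_nbhs (conj oU Ux)).
have cont (h h' : 'rV[R]_n -> R) x : (forall x, U x -> h x = h' x) -> U x ->
    {for x, continuous h} -> {for x, continuous h'}.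
  move=> hh' Ux ch; rewrite /prop_for /continuous_at -(hh' x Ux).
  apply: cvg_trans ch; exact: (near_eq_cvg (F := nbhs x) (nb h h' x hh' Ux)).
elim: k f g => [|k IH] f g fg [cf df]; split=> //.
- by move=> x Ux; exact: (cont f g x fg Ux (cf x Ux)).
- by move=> x Ux; exact: (cont f g x fg Ux (cf x Ux)).
move=> i; have [dfi cDf] := df i; split.
  by move=> x Ux; apply: near_eq_derivable (dfi x Ux); exact: nb.
apply: IH cDf => x Ux; apply: near_eq_derive; exact: nb.
Qed.

Lemma Ck_cst k U (c : R) : Ck k U (cst c).
Proof.
elim: k c => [|k IH] c; split=> //.
- by move=> x _; exact: cst_continuous.
- by move=> x _; exact: cst_continuous.
move=> i; split; first by move=> x _; exact: derivable_cst.
suff -> : 'D_(delta_mx 0 i) (cst c : 'rV[R]_n -> R) = cst 0 by exact: IH.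
by apply/funext => x; rewrite derive_cst.
Qed.

Lemma CkD k U f g : open U -> Ck k U f -> Ck k U g -> Ck k U (f + g).
Proof.
move=> oU; elim: k f g => [|k IH] f g [cf df] [cg dg]; split=> //.
- by move=> x Ux; apply: continuousD; [exact: cf | exact: cg].
- by move=> x Ux; apply: continuousD; [exact: cf | exact: cg].
move=> i; have [dfi cDf] := df i; have [dgi cDg] := dg i; split.
  by move=> x Ux; apply: derivableD; [exact: dfi | exact: dgi].
apply: (Ck_ext oU _ (IH _ _ cDf cDg)) => x Ux.
by rewrite deriveD; [| exact: dfi | exact: dgi].
Qed.

Lemma CkM k U f g : open U -> Ck k U f -> Ck k U g -> Ck k U (f * g).
Proof.
move=> oU; elim: k f g => [|k IH] f g cf cg.
  by split=> // x Ux; apply: continuousM; [exact: cf.1 | exact: cg.1].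
split; first by move=> x Ux; apply: continuousM; [exact: cf.1 | exact: cg.1].
move=> i; have [dfi cDf] := cf.2 i; have [dgi cDg] := cg.2 i; split.
  by move=> x Ux; apply: derivableM; [exact: dfi | exact: dgi].
apply: (Ck_ext oU _ (CkD oU (IH _ _ (CkS cf) cDg) (IH _ _ (CkS cg) cDf))).
by move=> x Ux; rewrite deriveM; [| exact: dfi | exact: dgi].
Qed.

End SmoothEuclidean.

(* The inverse cinv of a chart is a total function; only its values on the
   image of the chart domain are meaningful. *)
Record chart (R : realType) (n : nat) (T : topologicalType) := Chart {
  cdom : set T;
  cmap : T -> 'rV[R]_n;
  cinv : 'rV[R]_n -> T;
  cdom_open : open cdom;
  cimg_open : open (cmap @` cdom);
  cmapK : forall p, cdom p -> cinv (cmap p) = p;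
  cmap_continuous : forall p, cdom p -> {for p, continuous cmap};
  cinv_continuous : forall x, (cmap @` cdom) x -> {for x, continuous cinv}
}.

Record smoothManifold (R : realType) (n : nat) := SmoothManifold {
  mspace :> topologicalType;
  mspace_hausdorff : hausdorff_space mspace;
  mspace_second_countable : @second_countable mspace;
  atlas : set (chart R n mspace);
  atlas_cover : forall p, exists2 c, atlas c & cdom c p;
  atlas_compat : forall c d, atlas c -> atlas d -> forall i : 'I_n,
    smooth_on (cmap c @` (cdom c `&` cdom d))
              (fun x => cmap d (cinv c x) 0 i)
}.

Section SmoothFunctions.
Variables (R : realType) (n : nat) (M : smoothManifold R n).
Implicit Types (W : set M) (f g : M -> R).

(* Only used with W open. *)
Definition smooth_fun W f :=
  forall c, atlas c -> smooth_on (cmap c @` (cdom c `&` W)) (f \o cinv c).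

Lemma chart_img_open (c : chart R n M) W :
  open W -> open (cmap c @` (cdom c `&` W)).
Proof.
move=> oW.
have -> : cmap c @` (cdom c `&` W) = (cmap c @` cdom c) `&` cinv c @^-1` W.
  apply/seteqP; split=> x.
    by move=> [p [cp Wp] <-]; split; [exists p | rewrite /preimage/= cmapK].
  by move=> [[p cp <-]]; rewrite /preimage/= cmapK // => Wp; exists p.
rewrite openE => x [ix Wx]; apply: filterI.
  by apply: open_nbhs_nbhs; split => //; exact: cimg_open.
by apply: (cinv_continuous ix); apply: open_nbhs_nbhs.
Qed.

Lemma smooth_fun_cst W (a : R) : smooth_fun W (cst a).
Proof. by move=> c _ k; exact: Ck_cst. Qed.

Lemma smooth_funD W f g : open W ->
  smooth_fun W f -> smooth_fun W g -> smooth_fun W (fun p => f p + g p).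
Proof.
move=> oW sf sg c ac k.
exact: CkD (chart_img_open oW) (sf c ac k) (sg c ac k).
Qed.

Lemma smooth_funM W f g : open W ->
  smooth_fun W f -> smooth_fun W g -> smooth_fun W (fun p => f p * g p).
Proof.
move=> oW sf sg c ac k.
exact: CkM (chart_img_open oW) (sf c ac k) (sg c ac k).
Qed.

Lemma smooth_fun_sum W (m : nat) (f : 'I_m -> M -> R) : open W ->
  (forall i, smooth_fun W (f i)) -> smooth_fun W (fun p => \sum_i f i p).
Proof.
move=> oW sf.
suff : smooth_fun W (\sum_i f i) by rewrite fct_sumE.
elim/big_rec: _ => [|i x _ sx]; first exact: (smooth_fun_cst W 0).
exact: smooth_funD.
Qed.

Lemma smooth_fun_sub W W' f : W' `<=` W -> smooth_fun W f -> smooth_fun W' f.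
Proof.
move=> W'W sf c ac k; apply: Ck_sub (sf c ac k).
by apply: image_subset => p [cp /W'W].
Qed.

Lemma smooth_fun_ext W f g : open W -> (forall p, W p -> f p = g p) ->
  smooth_fun W f -> smooth_fun W g.
Proof.
move=> oW fg sf c ac k; apply: Ck_ext (chart_img_open oW) _ (sf c ac k).
by move=> _ [p [cp Wp] <-] /=; rewrite cmapK // fg.
Qed.

Lemma smooth_fun_glue W f (I : Type) (U : I -> set M) :
  (forall p, exists i, U i p) ->
  (forall i, smooth_fun (W `&` U i) f) -> smooth_fun W f.
Proof.
move=> cov sf c ac k.
apply: Ck_sub (_ : Ck k (\bigcup_(i in setT)
  (cmap c @` (cdom c `&` (W `&` U i)))) _).
  by move=> _ [p [cp Wp] <-]; have [i Up] := cov p; exists i => //; exists p.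
by apply: Ck_bigcup => i _; exact: sf.
Qed.

Definition smooth_pred : {pred M -> R} := [pred f | `[< smooth_fun setT f >]].

Record Cinf := MkCinf { cinf_fun :> M -> R; _ : cinf_fun \in smooth_pred }.
HB.instance Definition _ := [isSub for cinf_fun].
HB.instance Definition _ := [Choice of Cinf by <:].

Lemma smooth_predP f : reflect (smooth_fun setT f) (f \in smooth_pred).
Proof. by apply: (iffP idP) => [/asboolP|?] //; exact/asboolP. Qed.

Fact smooth_subring : subring_closed smooth_pred.
Proof.
have sM f g : f \in smooth_pred -> g \in smooth_pred -> f * g \in smooth_pred.
  by move=> /smooth_predP sf /smooth_predP sg; apply/smooth_predP/smooth_funM;
    first exact: openT.
split=> //; first exact/smooth_predP/smooth_fun_cst.
move=> f g sf sg; rewrite -mulN1r.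
apply/smooth_predP/smooth_funD; [exact: openT | exact/smooth_predP |].
apply/smooth_predP; apply: sM => //.
exact/smooth_predP/(smooth_fun_cst setT (- 1)).
Qed.
HB.instance Definition _ :=
  GRing.isSubringClosed.Build (M -> R) smooth_pred smooth_subring.
HB.instance Definition _ := GRing.SubChoice_isSubComPzRing.Build
  (M -> R) smooth_pred Cinf (subringClosedP _).

Fact smooth_scaler : scaler_closed smooth_pred.
Proof.
move=> a f /smooth_predP sf; apply/smooth_predP.
by apply: smooth_funM sf; [exact: openT | exact: smooth_fun_cst].
Qed.
HB.instance Definition _ :=
  GRing.isScaleClosed.Build R (M -> R) smooth_pred smooth_scaler.
HB.instance Definition _ := [SubZmodule_isSubLmodule of Cinf by <:].

End SmoothFunctions.

Section DependentFunctions.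
Variables (R : pzRingType) (T : Type) (V : T -> lmodType R).

(* All (not necessarily smooth) sections of a family of modules, with the
   pointwise module structure. *)
Definition dfun := forall p, V p.
Identity Coercion fun_of_dfun : dfun >-> Funclass.
Implicit Types s t u : dfun.

HB.instance Definition _ := gen_eqMixin dfun.
HB.instance Definition _ := gen_choiceMixin dfun.

Let dadd s t : dfun := fun p => s p + t p.
Let dopp s : dfun := fun p => - s p.
Let dzero : dfun := fun=> 0.
Let dscale (a : R) s : dfun := fun p => a *: s p.

Let daddA : associative dadd.
Proof. by move=> s t u; apply: functional_extensionality_dep => p; exact: addrA. Qed.
Let daddC : commutative dadd.
Proof. by move=> s t; apply: functional_extensionality_dep => p; exact: addrC. Qed.
Let dadd0 : left_id dzero dadd.
Proof. by move=> s; apply: functional_extensionality_dep => p; exact: add0r. Qed.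
Let daddN : left_inverse dzero dopp dadd.
Proof. by move=> s; apply: functional_extensionality_dep => p; exact: addNr. Qed.
HB.instance Definition _ :=
  GRing.isZmodule.Build dfun daddA daddC dadd0 daddN.

Let dscaleA a b s : dscale a (dscale b s) = dscale (a * b) s.
Proof. by apply: functional_extensionality_dep => p; exact: scalerA. Qed.
Let dscale1 : left_id 1 dscale.
Proof. by move=> s; apply: functional_extensionality_dep => p; exact: scale1r. Qed.
Let dscaleDr : right_distributive dscale +%R.
Proof. by move=> a s t; apply: functional_extensionality_dep => p; exact: scalerDr. Qed.
Let dscaleDl s : {morph dscale^~ s : a b / a + b}.
Proof. by move=> a b; apply: functional_extensionality_dep => p; exact: scalerDl. Qed.
HB.instance Definition _ :=
  GRing.Zmodule_isLmodule.Build R dfun dscaleA dscale1 dscaleDr dscaleDl.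

End DependentFunctions.

Section VectorFields.
Variables (R : realType) (n : nat) (M : smoothManifold R n).

Definition derivation_at (p : M) : {pred Cinf M -> R} :=
  [pred v : Cinf M -> R | `[< scalar v /\
     forall f g : Cinf M, v (f * g) = f p * v g + g p * v f >]].

(* The tangent space at p, as the space of derivations at p. *)
Record tangent (p : M) :=
  MkTangent { tangent_fun :> Cinf M -> R; _ : tangent_fun \in derivation_at p }.
HB.instance Definition _ p := [isSub for @tangent_fun p].
HB.instance Definition _ p := [Choice of tangent p by <:].

Lemma derivation_atP p (v : Cinf M -> R) :
  reflect (scalar v /\ forall f g : Cinf M, v (f * g) = f p * v g + g p * v f)
          (v \in derivation_at p).
Proof. by apply: (iffP idP) => [/asboolP|?] //; exact/asboolP. Qed.

Fact derivation_at_submod p : submod_closed (derivation_at p).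
Proof.
split.
  apply/derivation_atP; split=> [a f g|f g].
    by rewrite /= mulr0 addr0.
  by rewrite /GRing.zero/= !mulr0 addr0.
move=> a v w /derivation_atP[lv dv] /derivation_atP[lw dw].
apply/derivation_atP; split=> [b f g|f g]; rewrite !fctE /= ?lv ?lw ?dv ?dw.
  by rewrite /GRing.scale/= !mulrDr addrACA !mulrA (mulrC a).
rewrite /GRing.scale/= !mulrDr addrACA.
by congr (_ + _ + (_ + _)); rewrite !mulrA [a * _]mulrC.
Qed.
HB.instance Definition _ p := GRing.isSubmodClosed.Build
  R (Cinf M -> R) (derivation_at p) (derivation_at_submod p).
HB.instance Definition _ p := [SubChoice_isSubLmodule of tangent p by <:].

Definition vfield_pred : {pred dfun tangent} :=
  [pred X : dfun tangent |
    `[< forall f : Cinf M, smooth_fun setT (fun p => X p f) >]].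

(* The smooth sections of TM. *)
Record vfield :=
  MkVfield { vfield_fun :> dfun tangent; _ : vfield_fun \in vfield_pred }.
HB.instance Definition _ := [isSub for vfield_fun].
HB.instance Definition _ := [Choice of vfield by <:].

Lemma vfield_predP (X : dfun tangent) :
  reflect (forall f : Cinf M, smooth_fun setT (fun p => X p f))
          (X \in vfield_pred).
Proof. by apply: (iffP idP) => [/asboolP|?] //; exact/asboolP. Qed.

Fact vfield_submod : submod_closed vfield_pred.
Proof.
split; first by apply/vfield_predP => f; exact: (smooth_fun_cst setT (0 : R)).
move=> a X Y /vfield_predP sX /vfield_predP sY; apply/vfield_predP => f.
apply: smooth_funD (sY f); first exact: openT.
by apply: smooth_funM (sX f); [exact: openT | exact: smooth_fun_cst].
Qed.
HB.instance Definition _ := GRing.isSubmodClosed.Build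
  R (dfun tangent) vfield_pred vfield_submod.
HB.instance Definition _ := [SubChoice_isSubLmodule of vfield by <:].

Definition vapply_subproof (X : vfield) (f : Cinf M) :
  (fun p => X p f) \in @smooth_pred R n M.
Proof. by apply/smooth_predP; have /vfield_predP := valP X; exact. Qed.

(* The function X(f). *)
Definition vapply (X : vfield) (f : Cinf M) : Cinf M :=
  MkCinf (vapply_subproof X f).

Fact vapply_linear X : linear (vapply X).
Proof.
move=> a f g; apply/val_inj/funext => p /=.
by have /derivation_atP[-> _] := valP (X p).
Qed.

Fact vapplyM X f g : vapply X (f * g) = f * vapply X g + g * vapply X f.
Proof.
apply/val_inj/funext => p /=.
by have /derivation_atP[_ ->] := valP (X p).
Qed.

Fact lie_subproof1 (X Y : vfield) (p : M) :
  (fun f => X p (vapply Y f) - Y p (vapply X f)) \in derivation_at p.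
Proof.
have /derivation_atP[lX dX] := valP (X p).
have /derivation_atP[lY dY] := valP (Y p).
rewrite /= in lX dX lY dY.
apply/derivation_atP; split=> [a f g|f g].
  rewrite !vapply_linear lX lY mulrBr opprD addrACA; congr (_ + _).
have XD h k : X p (h + k) = X p h + X p k.
  by have := lX 1 h k; rewrite scale1r mul1r.
have YD h k : Y p (h + k) = Y p h + Y p k.
  by have := lY 1 h k; rewrite scale1r mul1r.
by rewrite !vapplyM XD YD !dX !dY /=; ring.
Qed.

Fact lie_subproof2 (X Y : vfield) :
  (fun p => MkTangent (lie_subproof1 X Y p)) \in vfield_pred.
Proof.
apply/vfield_predP => f /=.
have /smooth_predP := valP (vapply X (vapply Y f) - vapply Y (vapply X f)).
by [].
Qed.

(* [X, Y](f) = X(Y(f)) - Y(X(f)) *)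
Definition lie (X Y : vfield) : vfield := MkVfield (lie_subproof2 X Y).

End VectorFields.

(* A smooth vector bundle of constant rank, given by its fibres and a family of
   local trivializations with smooth transition functions; the total space is
   {p : M & fib p} with the projection projT1, topologized by the
   trivializations. The maps triv i p and trivI i p are only meaningful for p in
   the trivializing open set tdom i. *)
Record vbundle (R : realType) (n : nat) (M : smoothManifold R n) := Vbundle {
  rank : nat;
  fib : M -> lmodType R;
  tidx : Type;
  tdom : tidx -> set M;
  triv : forall (i : tidx) (p : M), {linear fib p -> 'rV[R]_rank};
  trivI : forall (i : tidx) (p : M), 'rV[R]_rank -> fib p;
  tdom_open : forall i, open (tdom i);
  tdom_cover : forall p, exists i, tdom i p;
  trivK : forall i p, tdom i p -> cancel (triv i p) (trivI i p);
  trivIK : forall i p, tdom i p -> cancel (trivI i p) (triv i p);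
  triv_smooth : forall i j (v : 'rV[R]_rank) (l : 'I_rank),
    smooth_fun (tdom i `&` tdom j) (fun p => triv j p (trivI i p v) 0 l)
}.

Section Sections.
Variables (R : realType) (n : nat) (M : smoothManifold R n) (E : vbundle M).

Definition section_pred : {pred dfun (@fib R n M E)} :=
  [pred s : dfun (@fib R n M E) | `[< forall (i : tidx E) (l : 'I_(rank E)),
     smooth_fun (tdom i) (fun p => triv i p (s p) 0 l) >]].

(* The space of smooth sections of E. *)
Record Gamma :=
  MkGamma { section_fun :> dfun (@fib R n M E); _ : section_fun \in section_pred }.
HB.instance Definition _ := [isSub for section_fun].
HB.instance Definition _ := [Choice of Gamma by <:].

Lemma section_predP (s : dfun (@fib R n M E)) :
  reflect (forall (i : tidx E) (l : 'I_(rank E)),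
             smooth_fun (tdom i) (fun p => triv i p (s p) 0 l))
          (s \in section_pred).
Proof. by apply: (iffP idP) => [/asboolP|?] //; exact/asboolP. Qed.

Fact section_submod : submod_closed section_pred.
Proof.
split.
  apply/section_predP => i l; apply: smooth_fun_ext (smooth_fun_cst _ 0).
    exact: tdom_open.
  by move=> p _; rewrite linear0 mxE.
move=> a s t /section_predP ss /section_predP st; apply/section_predP => i l.
have oi := tdom_open i.
have sas : smooth_fun (tdom i) (fun p => a * triv i p (s p) 0 l).
  by apply: smooth_funM (ss i l) => //; exact: smooth_fun_cst.
apply: smooth_fun_ext (smooth_funD oi sas (st i l)) => // p _.
by rewrite linearP !mxE.
Qed.
HB.instance Definition _ := GRing.isSubmodClosed.Build
  R (dfun (@fib R n M E)) section_pred section_submod.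
HB.instance Definition _ := [SubChoice_isSubLmodule of Gamma by <:].

Fact fmul_subproof (f : Cinf M) (s : Gamma) :
  (fun p => f p *: s p) \in section_pred.
Proof.
apply/section_predP => i l; have /section_predP ss := valP s.
have /smooth_predP sf := valP f.
apply: smooth_fun_ext
  (smooth_funM (tdom_open i) (smooth_fun_sub (@subsetT _ _) sf) (ss i l)).
  exact: tdom_open.
by move=> p _; rewrite linearZ mxE.
Qed.

Definition fmul (f : Cinf M) (s : Gamma) : Gamma := MkGamma (fmul_subproof f s).

End Sections.

Notation "f *:: s" := (fmul f s) (at level 40, left associativity) : ring_scope.

Section BundleIsomorphism.
Variables (R : realType) (n : nat) (M : smoothManifold R n).

(* Smoothness of a fibrewise map, read in local trivializations; meant for
   fibrewise linear maps. *)
Definition smooth_bundle_map (E F : vbundle M)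
    (phi : forall p : M, fib E p -> fib F p) :=
  forall (i : tidx E) (j : tidx F) (v : 'rV[R]_(rank E)) (l : 'I_(rank F)),
    smooth_fun (tdom i `&` tdom j)
      (fun p => triv j p (phi p (trivI i p v)) 0 l).

Variables E F : vbundle M.

(* Isomorphisms of vector bundles covering the identity of M. *)
Record bundleIso := BundleIso {
  bmap : forall p : M, {linear fib E p -> fib F p};
  binv : forall p : M, {linear fib F p -> fib E p};
  bmapK : forall p, cancel (bmap p) (binv p);
  binvK : forall p, cancel (binv p) (bmap p);
  bmap_smooth : smooth_bundle_map bmap;
  binv_smooth : smooth_bundle_map binv
}.

Variable Phi : bundleIso.

Fact push_subproof (s : Gamma E) :
  (fun p => bmap Phi p (s p)) \in @section_pred R n M F.
Proof.
apply/section_predP => j l; have /section_predP ss := valP s.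
apply: (smooth_fun_glue (U := @tdom _ _ _ E)); first exact: tdom_cover.
move=> i; have oij : open (tdom j `&` tdom i).
  by apply: openI; exact: tdom_open.
have : smooth_fun (tdom j `&` tdom i) (fun p => \sum_(k < rank E)
    triv i p (s p) 0 k *
    triv j p (bmap Phi p (trivI i p (delta_mx 0 k))) 0 l).
  apply: smooth_fun_sum => // k; apply: smooth_funM => //.
    by apply: smooth_fun_sub (ss i k) => p [].
  by rewrite setIC; exact: bmap_smooth.
apply: smooth_fun_ext => // p [jp ip].
have sE : s p =
    \sum_(k < rank E) triv i p (s p) 0 k *: trivI i p (delta_mx 0 k).
  apply: (can_inj (trivK ip)); rewrite linear_sum [LHS]row_sum_delta.
  by apply: eq_bigr => k _; rewrite linearZ /= trivIK.
rewrite [in RHS]sE !linear_sum summxE; apply: eq_bigr => k _.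
by rewrite !linearZ mxE.
Qed.

Definition push (s : Gamma E) : Gamma F := MkGamma (push_subproof s).

End BundleIsomorphism.

Section Whitney.
Variables (R : realType) (n : nat) (M : smoothManifold R n) (A B : vbundle M).

Definition whitney_triv (ij : tidx A * tidx B) (p : M)
    (v : fib A p * fib B p) : 'rV[R]_(rank A + rank B) :=
  row_mx (triv ij.1 p v.1) (triv ij.2 p v.2).

Definition whitney_trivI (ij : tidx A * tidx B) (p : M)
    (x : 'rV[R]_(rank A + rank B)) : (fib A p * fib B p)%type :=
  (trivI ij.1 p (lsubmx x), trivI ij.2 p (rsubmx x)).

Fact whitney_triv_linear ij p : linear (whitney_triv ij (p := p)).
Proof.
move=> a v w; rewrite /whitney_triv !linearP /=.
by rewrite scale_row_mx add_row_mx.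
Qed.
HB.instance Definition _ ij p := GRing.isLinear.Build R
  (fib A p * fib B p)%type 'rV[R]_(rank A + rank B) _
  (whitney_triv ij (p := p)) (whitney_triv_linear ij (p := p)).

Definition whitney_dom (ij : tidx A * tidx B) : set M :=
  tdom ij.1 `&` tdom ij.2.

Fact whitney_open ij : open (whitney_dom ij).
Proof. by apply: openI; exact: tdom_open. Qed.

Fact whitney_cover p : exists ij, whitney_dom ij p.
Proof.
by have [i ip] := tdom_cover A p; have [j jp] := tdom_cover B p; exists (i, j).
Qed.

Fact whitney_trivK ij p :
  whitney_dom ij p -> cancel (whitney_triv ij (p := p)) (whitney_trivI ij p).
Proof.
move=> [ip jp] [v w]; rewrite /whitney_trivI /whitney_triv /=.
by rewrite row_mxKl row_mxKr !trivK.
Qed.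

Fact whitney_trivIK ij p :
  whitney_dom ij p -> cancel (whitney_trivI ij p) (whitney_triv ij (p := p)).
Proof.
move=> [ip jp] x; rewrite /whitney_trivI /whitney_triv /=.
by rewrite !trivIK // hsubmxK.
Qed.

Fact whitney_smooth ij ij' (x : 'rV[R]_(rank A + rank B))
    (l : 'I_(rank A + rank B)) :
  smooth_fun (whitney_dom ij `&` whitney_dom ij')
    (fun p => whitney_triv ij' (whitney_trivI ij p x) 0 l).
Proof.
have oW : open (whitney_dom ij `&` whitney_dom ij').
  by apply: openI; exact: whitney_open.
case: (split_ordP l) => k ->.
  apply: smooth_fun_ext (smooth_fun_sub _ (triv_smooth ij.1 ij'.1 (lsubmx x) k)).
  - exact: oW.
  - by move=> p _; rewrite /whitney_triv row_mxEl.
  - by move=> p [[? ?] [? ?]].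
apply: smooth_fun_ext (smooth_fun_sub _ (triv_smooth ij.2 ij'.2 (rsubmx x) k)).
- exact: oW.
- by move=> p _; rewrite /whitney_triv row_mxEr.
- by move=> p [[? ?] [? ?]].
Qed.

(* The fibrewise direct product of A and B. *)
Definition whitney : vbundle M := Vbundle
  (triv := fun ij p => whitney_triv ij (p := p) :
     {linear (fib A p * fib B p)%type -> 'rV[R]_(rank A + rank B)})
  whitney_open whitney_cover whitney_trivK whitney_trivIK whitney_smooth.

Fact pair_subproof (X : Gamma A) (eta : Gamma B) :
  (fun p => (X p, eta p)) \in @section_pred R n M whitney.
Proof.
have /section_predP sX := valP X; have /section_predP sE := valP eta.
apply/section_predP => ij l /=; have oW := whitney_open ij.
case: (split_ordP l) => k ->.
  apply: smooth_fun_ext (smooth_fun_sub _ (sX ij.1 k)).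
  - exact: oW.
  - by move=> p _; rewrite /whitney_triv row_mxEl.
  - by move=> p [].
apply: smooth_fun_ext (smooth_fun_sub _ (sE ij.2 k)).
- exact: oW.
- by move=> p _; rewrite /whitney_triv row_mxEr.
- by move=> p [].
Qed.

(* The section (X, eta) of the Whitney sum. *)
Definition gpair (X : Gamma A) (eta : Gamma B) : Gamma whitney :=
  MkGamma (pair_subproof X eta).

Fact gfst_subproof (s : Gamma whitney) :
  (fun p => (s p).1) \in @section_pred R n M A.
Proof.
have /section_predP ss := valP s; apply/section_predP => i l.
apply: (smooth_fun_glue (U := @tdom _ _ _ B)) => [|j]; first exact: tdom_cover.
apply: smooth_fun_ext (ss (i, j) (lshift _ l)).
  exact: (whitney_open (i, j)).
by move=> p _; rewrite /= /whitney_triv row_mxEl.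
Qed.
Definition gfst (s : Gamma whitney) : Gamma A := MkGamma (gfst_subproof s).

Fact gsnd_subproof (s : Gamma whitney) :
  (fun p => (s p).2) \in @section_pred R n M B.
Proof.
have /section_predP ss := valP s; apply/section_predP => j l.
apply: (smooth_fun_glue (U := @tdom _ _ _ A)) => [|i]; first exact: tdom_cover.
rewrite setIC; apply: smooth_fun_ext (ss (i, j) (rshift _ l)).
  exact: (whitney_open (i, j)).
by move=> p _; rewrite /= /whitney_triv row_mxEr.
Qed.
Definition gsnd (s : Gamma whitney) : Gamma B := MkGamma (gsnd_subproof s).

Fact gfst_linear : linear gfst.
Proof. by move=> a s t; apply/val_inj. Qed.
HB.instance Definition _ := GRing.isLinear.Build R _ _ _ gfst gfst_linear.

Fact gsnd_linear : linear gsnd.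
Proof. by move=> a s t; apply/val_inj. Qed.
HB.instance Definition _ := GRing.isLinear.Build R _ _ _ gsnd gsnd_linear.

End Whitney.

Section Multilinear.
Variables (R : realType) (U V W Z : lmodType R).

Definition bilinear_map (h : U -> V -> Z) : Prop :=
  (forall y, linear (h^~ y)) /\ (forall x, linear (h x)).

Definition trilinear_map (h : U -> V -> W -> Z) : Prop :=
  [/\ forall y z, linear (fun x => h x y z),
      forall x z, linear (fun y => h x y z) &
      forall x y, linear (fun z => h x y z)].

Definition skew2 (h : U -> U -> Z) : Prop := forall x y, h y x = - h x y.

(* Skew-symmetry under the transpositions (1 2) and (2 3), hence under all
   permutations of the three arguments. *)
Definition skew3 (h : U -> U -> U -> Z) : Prop :=
  (forall x y z, h y x z = - h x y z) /\ (forall x y z, h x z y = - h x y z).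

End Multilinear.

Record anchoredBundle3 (R : realType) (n : nat) (M : smoothManifold R n) :=
  AnchoredBundle3 {
    abundle :> vbundle M;
    anchor : Gamma abundle -> Gamma abundle -> vfield M;
    anchor_bilinear : bilinear_map anchor;
    anchor_skew : skew2 anchor
  }.
Arguments anchor {R n M} _ _ _.

Section LieAlgebroid3.
Variables (R : realType) (n : nat) (M : smoothManifold R n).

Record is_lie3_bracket (E : anchoredBundle3 M)
    (br : Gamma E -> Gamma E -> Gamma E -> Gamma E) : Prop := IsLie3Bracket {
  br_trilinear : trilinear_map br;
  br_skew : skew3 br;
  br_anchor : forall X1 X2 Y1 Y2,
    anchor E (br X1 X2 Y1) Y2 + anchor E Y1 (br X1 X2 Y2) =
    lie (anchor E X1 X2) (anchor E Y1 Y2);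
  br_jacobi : forall X1 X2 Y1 Y2 Y3,
    br X1 X2 (br Y1 Y2 Y3) =
    br (br X1 X2 Y1) Y2 Y3 + br Y1 (br X1 X2 Y2) Y3 + br Y1 Y2 (br X1 X2 Y3);
  br_leibniz : forall X1 X2 Y (f : Cinf M),
    br X1 X2 (f *:: Y) = f *:: br X1 X2 Y + vapply (anchor E X1 X2) f *:: Y
}.

Arguments is_lie3_bracket : clear implicits.

Record lieAlgebroid3 := LieAlgebroid3 {
  lie3_anchored :> anchoredBundle3 M;
  bracket : Gamma lie3_anchored -> Gamma lie3_anchored ->
            Gamma lie3_anchored -> Gamma lie3_anchored;
  bracketP : is_lie3_bracket lie3_anchored bracket
}.
Arguments bracket : clear implicits.

(* An isomorphism of vector bundles identifying two 3-Lie algebroids. *)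
Definition lie3_iso (E F : lieAlgebroid3) (Phi : bundleIso E F) : Prop :=
  (forall s1 s2, anchor F (push Phi s1) (push Phi s2) = anchor E s1 s2) /\
  (forall s1 s2 s3, bracket F (push Phi s1) (push Phi s2) (push Phi s3) =
                    push Phi (bracket E s1 s2 s3)).

End LieAlgebroid3.
Arguments is_lie3_bracket {R n M} E br.
Arguments bracket {R n M} _ _ _ _.
Arguments lie3_iso {R n M} E F Phi.

Section Bicocycle.
Variables (R : realType) (n : nat) (M : smoothManifold R n).
Variables (A B : anchoredBundle3 M).

Record bicocycleData := BicocycleData {
  bphi : Gamma A -> Gamma A -> Gamma A -> Gamma A;
  bzeta : Gamma A -> Gamma A -> Gamma A -> Gamma B;
  bpsi : Gamma B -> Gamma B -> Gamma B -> Gamma A;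
  btheta : Gamma B -> Gamma B -> Gamma B -> Gamma B;
  brho : Gamma B -> Gamma B -> Gamma A -> Gamma A;
  bsigma : Gamma B -> Gamma A -> Gamma A -> Gamma B;
  bphi_alt : trilinear_map bphi /\ skew3 bphi;
  bzeta_alt : trilinear_map bzeta /\ skew3 bzeta;
  bpsi_alt : trilinear_map bpsi /\ skew3 bpsi;
  btheta_alt : trilinear_map btheta /\ skew3 btheta;
  brho_alt : trilinear_map brho /\ forall X, skew2 (fun e1 e2 => brho e1 e2 X);
  bsigma_alt : trilinear_map bsigma /\ forall eta, skew2 (bsigma eta)
}.

Definition bicocycle_anchor (s1 s2 : Gamma (whitney A B)) : vfield M :=
  anchor A (gfst s1) (gfst s2) + anchor B (gsnd s1) (gsnd s2).

Fact bicocycle_anchor_bilinear : bilinear_map bicocycle_anchor.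
Proof.
have [lA rA] := anchor_bilinear A; have [lB rB] := anchor_bilinear B.
split=> s a u v; rewrite /bicocycle_anchor !linearP ?lA ?lB ?rA ?rB;
  by rewrite scalerDr addrACA.
Qed.

Fact bicocycle_anchor_skew : skew2 bicocycle_anchor.
Proof.
move=> s t; rewrite /bicocycle_anchor opprD.
by rewrite (anchor_skew (a := A)) (anchor_skew (a := B)).
Qed.

Definition bicocycle_anchored : anchoredBundle3 M :=
  AnchoredBundle3 bicocycle_anchor_bilinear bicocycle_anchor_skew.

Variable D : bicocycleData.

Definition bicocycle_bracket (s1 s2 s3 : Gamma (whitney A B)) :
    Gamma (whitney A B) :=
  let X1 := gfst s1 in let X2 := gfst s2 in let X3 := gfst s3 in
  let e1 := gsnd s1 in let e2 := gsnd s2 in let e3 := gsnd s3 in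
  gpair
    (bphi D X1 X2 X3 + bpsi D e1 e2 e3
     + brho D e2 e3 X1 - brho D e1 e3 X2 + brho D e1 e2 X3)
    (btheta D e1 e2 e3 + bzeta D X1 X2 X3
     + bsigma D e3 X1 X2 - bsigma D e2 X1 X3 + bsigma D e1 X2 X3).

Definition bicocycle_product
    (h : is_lie3_bracket bicocycle_anchored bicocycle_bracket) :
  lieAlgebroid3 M := LieAlgebroid3 h.

End Bicocycle.

Section Decomposition.
Variables (R : realType) (n : nat) (M : smoothManifold R n).
Variables (E : lieAlgebroid3 M) (A B : anchoredBundle3 M).
Variable Phi : bundleIso (whitney A B) E.

(* Sections of A and B seen as sections of E. *)
Definition inA (X : Gamma A) : Gamma E := push Phi (gpair X 0).
Definition inB (eta : Gamma B) : Gamma E := push Phi (gpair 0 eta).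

Record decomposes (D : bicocycleData A B) : Prop := Decomposes {
  dec_AAA : forall X1 X2 X3, bracket E (inA X1) (inA X2) (inA X3) =
    inA (bphi D X1 X2 X3) + inB (bzeta D X1 X2 X3);
  dec_BBB : forall e1 e2 e3, bracket E (inB e1) (inB e2) (inB e3) =
    inA (bpsi D e1 e2 e3) + inB (btheta D e1 e2 e3);
  dec_BBA : forall e1 e2 X, bracket E (inB e1) (inB e2) (inA X) =
    inA (brho D e1 e2 X);
  dec_BAA : forall e X1 X2, bracket E (inB e) (inA X1) (inA X2) =
    inB (bsigma D e X1 X2)
}.

End Decomposition.
Arguments inA {R n M E A B} Phi X.
Arguments inB {R n M E A B} Phi eta.
Arguments decomposes {R n M E A B} Phi D.

(* Main.v *)
Require Import Defs.
From mathcomp Require Import all_boot all_order all_algebra.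
From mathcomp Require Import all_classical all_reals all_analysis.
From HB Require Import structures.
From mathcomp Require Import ring lra.

(** Write every section of E as X + eta with X in A and eta in B, and expand
the bracket of three such sums by trilinearity. Of the eight resulting terms
the pure ones are given by phi, zeta, psi and theta; a permutation of the
arguments brings each mixed one to the form [eta1, eta2, X] or [eta, X1, X2],
so it is a value of rho or sigma, with the sign of the permutation. This is the
bicocycle bracket ([push_bracket]), and the maps are trilinear and skew because
they are components of the bracket of E.

The point that is not formal concerns the anchor. That of the double cross
product has no term mixing A and B, so a(eta, X) = 0 has to be shown. It follows
from the Leibniz rule: in
  [eta, X, f Y] = f [eta, X, Y] + a(eta, X)(f) Y
the two brackets lie in B while the last term lies in A, hence
a(eta, X)(f) Y = 0 for every Y in Gamma(A) ([mixed_anchor_fmul]). Provided that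
each point carries a section Y of A that is nonzero there ([section_neq0]),
a(eta, X)(f) vanishes everywhere. If A has rank 0 there is no such Y, but then
X = 0 and a(eta, X) = 0 by linearity ([mixed_anchor]).

A section with a prescribed nonzero value is a local frame vector cut off by a
bump function ([smooth_bump]), made from the functions p(1/t) exp(-1/t) on the
half line t > 0 extended by 0. These form a family stable under differentiation
([flat_is_derive]), which makes every composite with a smooth function smooth
([Ck_outer_comp]). The bump function lives on the image of a compact box under
the inverse of a chart, and this image is closed because M is Hausdorff; this
is what makes its extension by 0 smooth.

With the bracket and the anchor matched, the axioms of a 3-Lie algebroid are
carried from E to the Whitney sum by the isomorphism
([is_lie3_bracket_transport]). *)

Set Implicit Arguments.
Unset Strict Implicit.
Unset Printing Implicit Defensive.

Import Order.TTheory GRing.Theory Num.Theory.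
Import numFieldNormedType.Exports.

Local Open Scope classical_set_scope.
Local Open Scope ring_scope.

(** * Smooth functions flat at the origin *)

Section FlatFunctions.
Variable R : realType.
Implicit Types (p : {poly R}) (s t : R).

(** The polynomial factor is what makes the family stable under differentiation;
the value 0 for t <= 0 makes a member vanish outside a half line. *)
Definition flat p t : R :=
  if 0 < t then p.[t^-1] * expR (- t^-1) else 0.

(** The extra power of s is what the induction on p needs: multiplying p by the
variable is absorbed by raising k. *)
Lemma poly_le_expR p k :
  exists C, forall s, 0 <= s -> `|p.[s]| * s ^+ k <= C * expR s.
Proof.
elim/poly_ind: p k => [|p c IHp] k.
  by exists 0 => s s0; rewrite horner0 normr0 !mul0r.
have [C HC] := IHp k.+1.
(* The constant term of p is bounded by a single term of the exponential
   series. *)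
have Hk s : 0 <= s -> s ^+ k <= k`!%:R * expR s.
  case: k {IHp HC} => [|k] s0.
    by rewrite expr0 fact0 mul1r (le_trans _ (expR_ge1Dx s)) // lerDl.
  have k0 : 0 < k.+1`!%:R :> R by rewrite ltr0n fact_gt0.
  rewrite -ler_pdivrMl // mulrC (le_trans _ (expR_ge1Dxn k s0)) //.
  by rewrite lerDr.
exists (C + `|c| * k`!%:R) => s s0; rewrite hornerMXaddC.
rewrite (le_trans (ler_wpM2r _ (ler_normD _ _))) ?exprn_ge0 //.
rewrite !mulrDl lerD //.
  by rewrite normrM (ger0_norm s0) -mulrA -exprS HC.
by rewrite -mulrA ler_wpM2l // Hk.
Qed.

(** With s = 1/t this is [poly_le_expR] for k = 1. Nothing more is needed at the
origin: the linear bound gives continuity, and continuity for p * 'X gives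
differentiability for p. *)
Lemma flat_bound p : exists C, forall t, `|flat p t| <= C * `|t|.
Proof.
have [C HC] := poly_le_expR p 1; exists C => t; rewrite /flat.
have C0 : 0 <= C.
  by have := HC 0 (lexx _); rewrite expr1 mulr0 expR0 mulr1.
case: ifPn => [t0|_]; last by rewrite normr0 mulr_ge0.
have ti : 0 <= t^-1 by rewrite invr_ge0 ltW.
rewrite normrM (gtr0_norm (expR_gt0 _)) (gtr0_norm t0).
rewrite -ler_pdivrMr // mulrAC expRN ler_pdivrMr ?expR_gt0 //.
by rewrite -[X in _ * X]expr1 HC.
Qed.

Lemma flat_cvg0 p : flat p t @[t --> 0] --> (0 : R).
Proof.
have [C HC] := flat_bound p.
apply/norm_cvg0P; apply: (@squeeze_cvgr _ _ _ _ (cst 0) (fun t => C * `|t|)).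
- by near=> t; rewrite normr_ge0 HC.
- exact: cvg_cst.
- have n0 : `|t| @[t --> (0 : R)] --> `|0 : R|.
    by apply: cvg_norm; exact: cvg_id.
  have := cvgMl_tmp (a := C) n0; rewrite normr0 mulr0 => h; exact: h.
Unshelve. all: by end_near. Qed.

(** With s = 1/t one has ds/dt = - s^2, so that the derivative of
p(s) exp(-s) in t is (p - p')(s) s^2 exp(-s). *)
Definition flat_deriv p : {poly R} := (p - p^`()) * 'X^2.

Lemma flat_is_derive p t : is_derive t 1 (flat p) (flat (flat_deriv p) t).
Proof.
have [t0|t0|->] := ltgtP t 0.
- rewrite {2}/flat ltNge (ltW t0) /=.
  apply: (near_eq_is_derive (f := cst 0)) => //.
  near=> u; rewrite /flat ltNge ltW //=.
  by near: u; exact: lt_nbhsl.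
- have tn : t != 0 by rewrite gt_eqF.
  apply: (@near_eq_is_derive R R R (fun u : R => p.[u^-1] * expR (- u^-1))).
    near=> u; rewrite /flat ifT //.
    by near: u; exact: lt_nbhsr.
  have di : is_derive t 1 (fun u : R => u^-1) (- (t ^- 2)).
    by apply: is_derive_eq (is_deriveV tn (is_derive_id t 1)) _;
      rewrite /GRing.scale /= mulr1.
  have dp : is_derive t 1 (fun u => p.[u^-1]) (p^`().[t^-1] * - t ^- 2).
    exact: is_derive1_comp (is_derive_poly _ _) di.
  have de : is_derive t 1 (fun u => expR (- u^-1)) (expR (- t^-1) * t ^- 2).
    rewrite -[t ^- 2]opprK.
    exact: is_derive1_comp (is_derive_expR _) (is_deriveN di).
  apply: is_derive_eq (is_deriveM dp de) _.
  rewrite /flat t0 /flat_deriv !hornerE /GRing.scale /= -exprVn.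
  by ring.
(* The difference quotient of flat p at 0 is flat (p * 'X). *)
- suff c0 : (h^-1 *: ((flat p \o shift 0) (h *: 1) - flat p 0)) @[h --> 0^']
      --> (0 : R).
    have -> : flat (flat_deriv p) 0 = 0 by rewrite /flat ltxx.
    by apply: DeriveDef; [apply/cvg_ex; exists 0 | exact: cvg_lim].
  have -> : (fun h => h^-1 *: ((flat p \o shift 0) (h *: 1) - flat p 0)) =
      flat (p * 'X).
    apply/funext => h; rewrite /flat ltxx subr0 /= /GRing.scale /= mulr1 addr0.
    by case: ifP => _; rewrite ?mulr0 // hornerMX; ring.
  by apply: cvg_trans (flat_cvg0 (p * 'X)); exact: cvg_app (@nbhs_dnbhs _ _).
Unshelve. all: by end_near. Qed.

End FlatFunctions.

Section OuterComposition.
Variables (R : realType) (n : nat).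
Implicit Types (U : set 'rV[R]_n) (f : 'rV[R]_n -> R).

(** Only the directional derivative of f along v is available, so the chain rule
is applied to the restriction of f to the line through x directed by v. *)
Lemma is_derive_outer_comp (g : R -> R) f x v dg : derivable f x v ->
  is_derive (f x) 1 g dg -> is_derive x v (g \o f) (dg * 'D_v f x).
Proof.
move=> df dgx.
pose L h := h *: v + x.
have dq (k : 'rV[R]_n -> R) : (fun h => h^-1 *: ((k \o shift x) (h *: v) - k x))
    = (fun h => h^-1 *: (((k \o L) \o shift (0 : R)) (h *: 1) - (k \o L) 0)).
  by apply/funext => h; rewrite /L /= addr0 [h%:A]mulr1 scale0r add0r.
have dfL : is_derive (0 : R) 1 (f \o L) ('D_v f x).
  apply: DeriveDef; first by move: df; rewrite /derivable dq.
  by rewrite /derive dq.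
have dgL : is_derive ((f \o L) 0) 1 g dg by rewrite /L /= scale0r add0r.
have [] := is_derive1_comp dgL dfL.
by rewrite /derivable /derive -!(dq (g \o f)) => *; apply: DeriveDef.
Qed.

(** As the derivatives of the functions g i are again in the family, the chain
rule expresses the partial derivatives of g i \o f by products to which the
induction on k applies. *)
Lemma Ck_outer_comp (I : Type) (g : I -> R -> R) (d : I -> I) :
    (forall i (t : R), is_derive t 1 (g i) (g (d i) t)) ->
  forall k i U f, open U -> Ck k U f -> Ck k U (g i \o f).
Proof.
move=> gd k i U f oU.
have gc j : continuous (g j).
  move=> t; apply/differentiable_continuous/derivable1_diffP.
  by have [] := gd j t.
elim: k i => [|k IH] i cf.
  by split=> // x Ux; apply: continuous_comp; [exact: cf.1 | exact: gc].
split; first by move=> x Ux; apply: continuous_comp; [exact: cf.1 | exact: gc].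
move=> j; have [dfj cDf] := cf.2 j.
have dj x (Ux : U x) := is_derive_outer_comp (dfj x Ux) (gd i (f x)).
split; first by move=> x Ux; have [] := dj x Ux.
apply: (Ck_ext oU _ (CkM oU (IH (d i) (CkS cf)) cDf)) => x Ux.
by have [_ ->] := dj x Ux.
Qed.

End OuterComposition.

(** * Bump functions and sections with a nonzero value *)

Section BumpFunctions.
Variables (R : realType) (n : nat) (M : smoothManifold R n).
Implicit Types (W : set M) (f : M -> R).

Lemma smooth_fun_prod W (m : nat) (f : 'I_m -> M -> R) : open W ->
  (forall i, smooth_fun W (f i)) -> smooth_fun W (fun p => \prod_i f i p).
Proof.
move=> oW sf.
suff : smooth_fun W (\prod_i f i) by rewrite fct_prodE.
elim/big_rec: _ => [|i x _ sx]; first exact: (smooth_fun_cst W 1).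
exact: smooth_funM.
Qed.

Lemma smooth_fun_flat W (q : {poly R}) f : open W ->
  smooth_fun W f -> smooth_fun W (flat q \o f).
Proof.
move=> oW sf c ac k.
exact: (Ck_outer_comp (@flat_is_derive R) q (chart_img_open oW) (sf c ac k)).
Qed.

(** This is the smoothness of the transition maps of the atlas. *)
Lemma smooth_fun_coord (c : chart R n M) (i : 'I_n) : atlas c ->
  smooth_fun (cdom c) (fun p => cmap c p 0 i).
Proof. by move=> ac d ad; exact: atlas_compat. Qed.

(** In a chart around p, take the product over the coordinates of
flat 1 (r^2 - (x_i - p_i)^2), which is nonzero exactly when |x_i - p_i| < r for
all i, and extend it by 0 off the chart. It vanishes outside K, the image of a
closed box; K is compact, hence closed in the Hausdorff space M, and the
extension is smooth on both members of the open cover by the chart domain and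
the complement of K. *)
Lemma smooth_bump W p : open W -> W p -> exists (chi : M -> R) (K : set M),
  [/\ smooth_fun setT chi, chi p != 0, closed K, K `<=` W &
      forall q, ~ K q -> chi q = 0].
Proof.
move=> oW Wp; have [c ac cp] := atlas_cover p.
pose x0 := cmap c p.
have : nbhs x0 (cmap c @` (cdom c `&` W)).
  by apply: open_nbhs_nbhs; split; [exact: chart_img_open | exists p].
move=> /nbhs_ballP[e /= e0 eO]; pose r := e / 2.
have r0 : 0 < r by rewrite divr_gt0.
have re : r < e by rewrite ltr_pdivrMr // ltr_pMr // ltr1n.
pose box := [set x : 'rV[R]_n |
  forall i, `[x0 0 i - r, x0 0 i + r]%classic (x 0 i)].
have boxO : box `<=` cmap c @` (cdom c `&` W).
  move=> x bx; apply: eO; split => // i j; rewrite (ord1 i).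
  rewrite /ball /= ltr_norml; have := bx j; rewrite /= in_itv /= => /andP[].
  by move=> ? ?; apply/andP; split; lra.
have cbox : compact box.
  apply: (rV_compact (A := fun i => `[x0 0 i - r, x0 0 i + r]%classic)) => i.
  exact: segment_compact.
pose K := cinv c @` box.
have KW q : K q -> cdom c q /\ W q.
  by move=> [x /boxO[q' [cq' Wq'] <-] <-]; rewrite cmapK.
have clK : closed K.
  apply: compact_closed; first exact: mspace_hausdorff.
  apply: continuous_compact cbox; apply: continuous_in_subspaceT => x.
  rewrite inE => /boxO[q [cq Wq] <-]; apply: cinv_continuous.
  by exists q.
pose b q := \prod_i flat 1 (r ^+ 2 - (cmap c q 0 i - x0 0 i) ^+ 2).
pose chi q := if `[< cdom c q >] then b q else 0.
have chiK q : ~ K q -> chi q = 0.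
  rewrite /chi; case: asboolP => // cq nK.
  apply: contra_notP nK => /eqP /prodf_neq0 bn.
  exists (cmap c q); last exact: cmapK.
  move=> i; have := bn i isT; rewrite /flat; case: ifPn; rewrite ?eqxx //.
  rewrite subr_gt0 => lt_r _; have : `|cmap c q 0 i - x0 0 i| < r.
    by rewrite -ltr_sqr ?nnegrE ?(ltW r0) // real_normK ?num_real.
  by rewrite ltr_norml /= in_itv /= => /andP[? ?]; apply/andP; split; lra.
exists chi, K; split => //.
- apply: (smooth_fun_glue (U := fun a : bool => if a then cdom c else ~` K)).
    by move=> q; have [/KW[]|] := pselect (K q); [exists true | exists false].
  case; rewrite setTI.
    have oc := cdom_open c.
    have sb : smooth_fun (cdom c) b.
      apply: smooth_fun_prod => // i.
      apply: (@smooth_fun_flat _ 1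
        (fun q => r ^+ 2 - (cmap c q 0 i - x0 0 i) ^+ 2)) => //.
      have sd := smooth_funD oc (smooth_fun_coord i ac)
        (smooth_fun_cst _ (- x0 0 i)).
      apply: smooth_fun_ext (smooth_funD oc (smooth_fun_cst _ (r ^+ 2))
        (smooth_funM oc (smooth_fun_cst _ (- 1)) (smooth_funM oc sd sd))) => //.
      by move=> q _ /=; rewrite expr2; ring.
    by apply: smooth_fun_ext sb => // q cq; rewrite /chi asboolT.
  have oK : open (~` K) by exact: closed_openC.
  by apply: smooth_fun_ext (smooth_fun_cst _ 0) => // q Kq; rewrite chiK.
- rewrite /chi asboolT //; apply/prodf_neq0 => i _ /=.
  rewrite subrr expr0n subr0 /flat exprn_gt0 // hornerC mul1r.
  by rewrite gt_eqF ?expR_gt0.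
- by move=> q /KW[].
Qed.

(** A vector of the local frame, multiplied by a bump function supported in the
trivializing open set. *)
Lemma section_neq0 (E : vbundle M) p :
  (0 < rank E)%N -> exists s : Gamma E, s p != 0.
Proof.
move=> E0; pose k : 'I_(rank E) := Ordinal E0.
have [i ip] := tdom_cover E p.
have [chi [K [schi chip clK KW chiK]]] := smooth_bump (tdom_open i) ip.
pose s : dfun (@fib R n M E) := fun q => chi q *: trivI i q (delta_mx 0 k).
have ss : s \in @section_pred R n M E.
  apply/section_predP => j l.
  have onK : open (~` K) by exact: closed_openC.
  have oj := @tdom_open _ _ _ E j.
  apply: (smooth_fun_glue (U := fun b : bool => if b then tdom i else ~` K)).
    by move=> q; have [/KW|] := pselect (K q); [exists true | exists false].
  case.
    have oij : open (tdom j `&` tdom i) by apply: openI => //; exact: tdom_open.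
    apply: smooth_fun_ext (smooth_funM oij (smooth_fun_sub _ schi)
      (smooth_fun_sub _ (triv_smooth i j (delta_mx 0 k) l))) => //.
      by move=> q _; rewrite linearZ mxE.
    by move=> q [].
  have ojK : open (tdom j `&` ~` K) by exact: openI.
  apply: smooth_fun_ext (smooth_fun_cst _ 0) => // q [_ Kq].
  by rewrite /s chiK // scale0r linear0 mxE.
exists (MkGamma ss); apply/negP => /eqP /= sp0.
have := congr1 (triv i p) sp0; rewrite linearZ linear0 /= trivIK //.
move=> /matrixP /(_ 0 k); rewrite !mxE !eqxx mulr1 => /eqP.
by rewrite (negbTE chip).
Qed.

End BumpFunctions.

(** * Isomorphisms acting on sections *)

Lemma GammaP (R : realType) (n : nat) (M : smoothManifold R n)
    (E : vbundle M) (s t : Gamma E) : (forall p, s p = t p) -> s = t.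
Proof.
by move=> st; apply/val_inj/functional_extensionality_dep; exact: st.
Qed.

Section PushSections.
Variables (R : realType) (n : nat) (M : smoothManifold R n).
Variables (E F : vbundle M) (Phi : bundleIso E F).

Fact push_linear : linear (push Phi).
Proof. by move=> a s t; apply: GammaP => p; exact: linearP. Qed.
HB.instance Definition _ := GRing.isLinear.Build R _ _ _ (push Phi) push_linear.

Lemma push_fmul f s : push Phi (f *:: s) = f *:: push Phi s.
Proof. by apply: GammaP => p; exact: linearZ. Qed.

Definition bundleIso_inv : bundleIso F E :=
  BundleIso (binvK Phi) (bmapK Phi) (binv_smooth Phi) (bmap_smooth Phi).

Lemma pushK : cancel (push Phi) (push bundleIso_inv).
Proof. by move=> s; apply: GammaP => p; exact: bmapK. Qed.

End PushSections.

Lemma push_invK (R : realType) (n : nat) (M : smoothManifold R n)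
    (E F : vbundle M) (Phi : bundleIso E F) :
  cancel (push (bundleIso_inv Phi)) (push Phi).
Proof. by move=> s; apply: GammaP => p; exact: binvK. Qed.

Section Transport.
Variables (R : realType) (n : nat) (M : smoothManifold R n).

(** As the map on sections is injective and linear over the smooth functions,
each axiom can be checked after applying it. *)
Lemma is_lie3_bracket_transport (V : anchoredBundle3 M) (E : lieAlgebroid3 M)
    (Phi : bundleIso V E) (br : Gamma V -> Gamma V -> Gamma V -> Gamma V) :
    (forall s t, anchor V s t = anchor E (push Phi s) (push Phi t)) ->
    (forall s t u, push Phi (br s t u) =
       bracket E (push Phi s) (push Phi t) (push Phi u)) ->
  is_lie3_bracket V br.
Proof.
move=> hanc hbr; have inj := can_inj (pushK Phi).
have [[l1 l2 l3] [s12 s23] banc bjac blei] := bracketP E.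
split.
- split=> x y a u v; apply: inj; rewrite linearP /= !hbr linearP.
  + exact: l1.
  + exact: l2.
  + exact: l3.
- by split=> x y z; apply: inj; rewrite linearN /= !hbr; auto.
- by move=> x1 x2 y1 y2; rewrite !hanc !hbr banc.
- by move=> x1 x2 y1 y2 y3; apply: inj; rewrite !linearD /= !hbr bjac.
- move=> x1 x2 y f; apply: inj.
  by rewrite linearD /= !push_fmul !hbr push_fmul blei hanc.
Qed.

End Transport.

(** * Components of trilinear maps *)

Section Components.
Variable R : realType.

Lemma trilinear_map_comp (U1 U2 U3 V1 V2 V3 W Z : lmodType R)
    (h : V1 -> V2 -> V3 -> W) (f1 : {linear U1 -> V1}) (f2 : {linear U2 -> V2})
    (f3 : {linear U3 -> V3}) (g : {linear W -> Z}) : trilinear_map h ->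
  trilinear_map (fun x y z => g (h (f1 x) (f2 y) (f3 z))).
Proof.
move=> [h1 h2 h3]; split=> x y a u v; rewrite linearP.
- by rewrite h1 linearP.
- by rewrite h2 linearP.
- by rewrite h3 linearP.
Qed.

Lemma skew3_comp (U V W Z : lmodType R) (h : V -> V -> V -> W)
    (f : {linear U -> V}) (g : {linear W -> Z}) : skew3 h ->
  skew3 (fun x y z => g (h (f x) (f y) (f z))).
Proof.
by move=> [s12 s23]; split=> x y z; [rewrite s12 | rewrite s23];
  exact: linearN.
Qed.

End Components.

(** * Splitting a 3-Lie algebroid *)

(** The fields that are proofs agree by proof irrelevance. *)
Lemma bicocycleDataP (R : realType) (n : nat) (M : smoothManifold R n)
    (A B : anchoredBundle3 M) (D D' : bicocycleData A B) :
    (forall x y z, bphi D x y z = bphi D' x y z) ->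
    (forall x y z, bzeta D x y z = bzeta D' x y z) ->
    (forall x y z, bpsi D x y z = bpsi D' x y z) ->
    (forall x y z, btheta D x y z = btheta D' x y z) ->
    (forall x y z, brho D x y z = brho D' x y z) ->
    (forall x y z, bsigma D x y z = bsigma D' x y z) -> D = D'.
Proof.
have fE (S T U V : Type) (f g : S -> T -> U -> V) :
    (forall x y z, f x y z = g x y z) -> f = g.
  by move=> fg; apply/funext => x; apply/funext => y; apply/funext => z.
case: D D' => [p z s t r q ? ? ? ? ? ?] [p' z' s' t' r' q' ? ? ? ? ? ?] /=.
move=> /fE e1 /fE e2 /fE e3 /fE e4 /fE e5 /fE e6; subst.
by f_equal; exact: Prop_irrelevance.
Qed.

Section Splitting.
Variables (R : realType) (n : nat) (M : smoothManifold R n).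
Variables (E : lieAlgebroid3 M) (A B : anchoredBundle3 M).
Variable Phi : bundleIso (whitney A B) E.

Local Notation inA := (inA Phi).
Local Notation inB := (inB Phi).

Fact inA_linear : linear inA.
Proof.
move=> a X Y; rewrite /Defs.inA -linearP; congr push; apply: GammaP => p /=.
by congr pair; rewrite /= scaler0 addr0.
Qed.
HB.instance Definition _ := GRing.isLinear.Build R _ _ _ inA inA_linear.

Fact inB_linear : linear inB.
Proof.
move=> a X Y; rewrite /Defs.inB -linearP; congr push; apply: GammaP => p /=.
by congr pair; rewrite /= scaler0 addr0.
Qed.
HB.instance Definition _ := GRing.isLinear.Build R _ _ _ inB inB_linear.

Definition prA (t : Gamma E) : Gamma A := gfst (push (bundleIso_inv Phi) t).
Definition prB (t : Gamma E) : Gamma B := gsnd (push (bundleIso_inv Phi) t).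

Fact prA_linear : linear prA.
Proof. by move=> a s t; rewrite /prA !linearP. Qed.
HB.instance Definition _ := GRing.isLinear.Build R _ _ _ prA prA_linear.

Fact prB_linear : linear prB.
Proof. by move=> a s t; rewrite /prB !linearP. Qed.
HB.instance Definition _ := GRing.isLinear.Build R _ _ _ prB prB_linear.

Lemma prA_inA X : prA (inA X) = X.
Proof. by rewrite /prA pushK; apply: GammaP. Qed.

Lemma prA_inB e : prA (inB e) = 0.
Proof. by rewrite /prA pushK; apply: GammaP. Qed.

Lemma prB_inA X : prB (inA X) = 0.
Proof. by rewrite /prB pushK; apply: GammaP. Qed.

Lemma prB_inB e : prB (inB e) = e.
Proof. by rewrite /prB pushK; apply: GammaP. Qed.

Lemma push_split s : push Phi s = inA (gfst s) + inB (gsnd s).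
Proof.
rewrite /Defs.inA /Defs.inB -linearD; congr push; apply: GammaP => p /=.
transitivity ((s p).1 + 0, 0 + (s p).2) => //.
by rewrite addr0 add0r; case: (s p).
Qed.

Lemma inA_prA_inB_prB t : inA (prA t) + inB (prB t) = t.
Proof. by rewrite -push_split push_invK. Qed.

Lemma inA_fmul f X : inA (f *:: X) = f *:: inA X.
Proof.
rewrite -push_fmul; congr push; apply: GammaP => p /=.
by congr pair; rewrite /= scaler0.
Qed.

Lemma inB_fmul f e : inB (f *:: e) = f *:: inB e.
Proof.
rewrite -push_fmul; congr push; apply: GammaP => p /=.
by congr pair; rewrite /= scaler0.
Qed.

Hypothesis bracketBAA : forall (eta : Gamma B) (X1 X2 : Gamma A),
  exists xi : Gamma B, bracket E (inB eta) (inA X1) (inA X2) = inB xi.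

(** Project the Leibniz rule for [eta, X, f Y] to A: both brackets are sections
of B, and only the derivative term survives. *)
Lemma mixed_anchor_fmul eta X (Y : Gamma A) f :
  vapply (anchor E (inB eta) (inA X)) f *:: Y = 0.
Proof.
have [_ _ _ _ leibniz] := bracketP E.
have [xi xiE] := bracketBAA eta X (f *:: Y).
have [xi' xi'E] := bracketBAA eta X Y.
have := leibniz (inB eta) (inA X) (inA Y) f.
rewrite -inA_fmul xiE xi'E -inB_fmul -inA_fmul => /(congr1 prA).
by rewrite linearD /= !prA_inB prA_inA add0r.
Qed.

(** The section Y in [mixed_anchor_fmul] is arbitrary, so at each point it can
be chosen nonzero, whatever eta and X are there. *)
Lemma mixed_anchor eta X : anchor E (inB eta) (inA X) = 0.
Proof.
have [_ lr] := anchor_bilinear E.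
have [A0|A0] := posnP (rank A).
  (* In rank 0 the zero section is the only section. *)
  suff -> : X = 0.
    have := lr (inB eta) (-1) 0 0.
    by rewrite scaler0 addr0 scaleN1r addNr [inA 0]linear0.
  apply: GammaP => p; have [i ip] := tdom_cover A p.
  apply: (can_inj (trivK ip)); apply/rowP => k; exfalso.
  by have := ltn_ord k; rewrite [X in (_ < X)%N]A0.
apply/val_inj/functional_extensionality_dep => p; apply/val_inj/funext => f.
have [Y Yp] := section_neq0 p A0.
have := congr1 (fun s : Gamma A => s p) (mixed_anchor_fmul eta X Y f).
by move=> /eqP; rewrite scaler_eq0 (negbTE Yp) orbF => /eqP.
Qed.

Hypothesis anchorA : forall X1 X2 : Gamma A,
  anchor A X1 X2 = anchor E (inA X1) (inA X2).
Hypothesis anchorB : forall eta1 eta2 : Gamma B,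
  anchor B eta1 eta2 = anchor E (inB eta1) (inB eta2).

Lemma push_anchor s t :
  anchor (bicocycle_anchored A B) s t = anchor E (push Phi s) (push Phi t).
Proof.
have [l1 l2] := anchor_bilinear E.
have D1 u v w : anchor E (u + v) w = anchor E u w + anchor E v w.
  by have := l1 w 1 u v; rewrite !scale1r.
have D2 u v w : anchor E u (v + w) = anchor E u v + anchor E u w.
  by have := l2 u 1 v w; rewrite !scale1r.
rewrite !push_split D1 !D2 mixed_anchor add0r -anchorA -anchorB.
by rewrite (anchor_skew (inB _)) mixed_anchor oppr0 addr0.
Qed.

(** Each mixed term of the expansion has one argument of one kind and two of the
other; bringing it to the order used by rho and sigma costs a sign exactly when
the odd argument out is in the middle, which gives the two minus signs of the
bicocycle bracket. *)
Lemma push_bracket D : decomposes Phi D -> forall s t u,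
  push Phi (bicocycle_bracket D s t u) =
  bracket E (push Phi s) (push Phi t) (push Phi u).
Proof.
move=> [aaa bbb bba baa] s t u.
have [[l1 l2 l3] [s12 s23] _ _ _] := bracketP E.
have D1 x x' y z : bracket E (x + x') y z = bracket E x y z + bracket E x' y z.
  by have := l1 y z 1 x x'; rewrite !scale1r.
have D2 x y y' z : bracket E x (y + y') z = bracket E x y z + bracket E x y' z.
  by have := l2 x z 1 y y'; rewrite !scale1r.
have D3 x y z z' : bracket E x y (z + z') = bracket E x y z + bracket E x y z'.
  by have := l3 x y 1 z z'; rewrite !scale1r.
have aab X Y e : bracket E (inA X) (inA Y) (inB e) = inB (bsigma D e X Y).
  by rewrite s23 s12 opprK baa.
have aba X Y e : bracket E (inA X) (inB e) (inA Y) = - inB (bsigma D e X Y).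
  by rewrite s12 baa.
have abb X e e' : bracket E (inA X) (inB e) (inB e') = inA (brho D e e' X).
  by rewrite s12 s23 opprK bba.
have bab X e e' : bracket E (inB e) (inA X) (inB e') = - inA (brho D e e' X).
  by rewrite s23 bba.
rewrite !push_split !(D1, D2, D3) aaa aab aba abb baa bab bba bbb /=.
rewrite /bicocycle_bracket.
set x := bphi _ _ _ _ + _ + _ - _ + _; set y := btheta _ _ _ _ + _ + _ - _ + _.
have -> : gfst (gpair x y) = x by apply: GammaP.
have -> : gsnd (gpair x y) = y by apply: GammaP.
rewrite !linearD /= !linearN /=.
(* The right-hand side lists its terms in the order
   phi, zeta, sigma, sigma, rho, sigma, rho, rho, psi, theta. *)
by rewrite [RHS](AC ((3*2)*(2*(1*2)))
  ((((1*9)*5)*7*8)*(((10*2)*3)*4*6))).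
Qed.

Let tri := br_trilinear (bracketP E).
Let skew := br_skew (bracketP E).

Fact rho_skew X :
  skew2 (fun e1 e2 => prA (bracket E (inB e1) (inB e2) (inA X))).
Proof. by move=> e1 e2; rewrite skew.1 linearN. Qed.

Fact sigma_skew e :
  skew2 (fun X1 X2 => prB (bracket E (inB e) (inA X1) (inA X2))).
Proof. by move=> X1 X2; rewrite skew.2 linearN. Qed.

Definition bicocycle_of_bracket : bicocycleData A B := BicocycleData
  (conj (trilinear_map_comp inA inA inA prA tri) (skew3_comp inA prA skew))
  (conj (trilinear_map_comp inA inA inA prB tri) (skew3_comp inA prB skew))
  (conj (trilinear_map_comp inB inB inB prA tri) (skew3_comp inB prA skew))
  (conj (trilinear_map_comp inB inB inB prB tri) (skew3_comp inB prB skew))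
  (conj (trilinear_map_comp inB inB inA prA tri) rho_skew)
  (conj (trilinear_map_comp inB inA inA prB tri) sigma_skew).

Hypothesis bracketBBA : forall (eta1 eta2 : Gamma B) (X : Gamma A),
  exists Y : Gamma A, bracket E (inB eta1) (inB eta2) (inA X) = inA Y.

(** For the mixed brackets, the component that [bicocycle_of_bracket] discards
is zero by hypothesis. *)
Lemma bicocycle_of_bracketP : decomposes Phi bicocycle_of_bracket.
Proof.
split=> x y z; rewrite /= ?inA_prA_inB_prB //.
- by have [Y ->] := bracketBBA x y z; rewrite prA_inA.
- by have [xi ->] := bracketBAA x y z; rewrite prB_inB.
Qed.

Lemma decomposes_inj D D' : decomposes Phi D -> decomposes Phi D' -> D = D'.
Proof.
have injA X Y e f : inA X + inB e = inA Y + inB f -> X = Y.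
  by move=> /(congr1 prA); rewrite !linearD /= !prA_inA !prA_inB !addr0.
have injB X Y e f : inA X + inB e = inA Y + inB f -> e = f.
  by move=> /(congr1 prB); rewrite !linearD /= !prB_inA !prB_inB !add0r.
move=> [aaa bbb bba baa] [aaa' bbb' bba' baa'].
apply: bicocycleDataP => x y z.
- exact: injA (etrans (esym (aaa x y z)) (aaa' x y z)).
- exact: injB (etrans (esym (aaa x y z)) (aaa' x y z)).
- exact: injA (etrans (esym (bbb x y z)) (bbb' x y z)).
- exact: injB (etrans (esym (bbb x y z)) (bbb' x y z)).
- by apply: (can_inj prA_inA); rewrite -bba -bba'.
- by apply: (can_inj prB_inB); rewrite -baa -baa'.
Qed.

End Splitting.

Theorem proposition5p1 (R : realType) (n : nat) (M : smoothManifold R n)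
    (E : lieAlgebroid3 M) (A B : anchoredBundle3 M)
    (Phi : bundleIso (whitney A B) E)
    (anchorA : forall X1 X2 : Gamma A,
       anchor A X1 X2 = anchor E (inA Phi X1) (inA Phi X2))
    (anchorB : forall eta1 eta2 : Gamma B,
       anchor B eta1 eta2 = anchor E (inB Phi eta1) (inB Phi eta2))
    (bracketBBA : forall (eta1 eta2 : Gamma B) (X : Gamma A),
       exists Y : Gamma A,
         bracket E (inB Phi eta1) (inB Phi eta2) (inA Phi X) = inA Phi Y)
    (bracketBAA : forall (eta : Gamma B) (X1 X2 : Gamma A),
       exists xi : Gamma B,
         bracket E (inB Phi eta) (inA Phi X1) (inA Phi X2) = inB Phi xi) :
  (exists! D : bicocycleData A B, decomposes Phi D) /\
  (forall D : bicocycleData A B, decomposes Phi D ->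
     exists h : is_lie3_bracket (bicocycle_anchored A B) (bicocycle_bracket D),
       lie3_iso (bicocycle_product h) E Phi).
Proof.
have DP := bicocycle_of_bracketP bracketBAA bracketBBA.
split; first by eexists; split; [exact: DP | move=> D'; exact: decomposes_inj].
move=> D decD; have pa := push_anchor bracketBAA anchorA anchorB.
have pb := push_bracket decD.
exists (is_lie3_bracket_transport (V := bicocycle_anchored A B) pa pb).
by split=> [s t|s t u]; rewrite /= ?pb // -pa.
Qed.
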